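(* Let $a,b,c,d,e,f$ be nonzero integers with $\gcd(a,b)=\gcd(c,d)=\gcd(e,f)=1$, and suppose none of the three pairs $(a,b)$, $(c,d)$, $(e,f)$ is of the form $(\pm1,\pm1)$ (for any choice of signs). Then there exists a quotient $Q=Q(a,b;c,d;e,f)$ of $G=G(a,b;c,d;e,f)$ which is universal among all quotients of $G$ in which (the images of) $x$, $y$ and $z$ have finite order; that is, $x,y,z$ have finite order in $Q$, and any quotient of $G$ in which $x,y,z$ have finite order factors through $Q$. Furthermore, $Q$ is finite and solvable, and its commutator subgroup $Q'$ is nilpotent of class at most $2$. Finally, if any of $a,\dots,f$ is equal to $1$, then $G=Q$ (i.e. the quotient map $G\to Q$ is an isomorphism).
   Context: Conjugation convention: $x^y=y^{-1}xy$. For nonzero integers $a,\dots,f$, $$G(a,b;c,d;e,f)=\bigl\langle x,y,z \bigm| (x^a)^y=x^b,\ (y^c)^z=y^d,\ (z^e)^x=z^f\bigr\rangle .$$ *)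

(* Defs.v *)
From HB Require Import structures.
From mathcomp Require Import all_boot all_order all_algebra all_fingroup.
From mathcomp Require Import all_solvable.
From mathcomp Require Import boolp generic_quotient.

Set Implicit Arguments.
Unset Strict Implicit.
Unset Printing Implicit Defensive.

Local Open Scope group_scope.
Local Open Scope quotient_scope.

Definition expgz (G : baseGroupType) (g : G) (n : int) : G :=
  match n with Posz m => g ^+ m | Negz m => g ^- m.+1 end.

Definition finite_order (G : groupType) (g : G) : Prop :=
  exists2 n : nat, (0 < n)%N & g ^+ n = 1.

Definition surjective (A B : Type) (h : A -> B) : Prop :=
  forall y, exists x, h x = y.

(* The letter (i, false) is the generator i and (i, true) its formal inverse.
   Words are not reduced: they form a monoid with an involution reversing
   products, but not a group. *)
Definition word (X : choiceType) : Type := seq (X * bool).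

Section Word.
Variable X : choiceType.

HB.instance Definition _ := Choice.on (word X).

Definition letterV (l : X * bool) : X * bool := (l.1, ~~ l.2).
Definition word_mul (u v : word X) : word X := u ++ v.
Definition word_inv (u : word X) : word X := rev (map letterV u).

Lemma word_mulA : associative word_mul.
Proof. exact: catA. Qed.

Lemma word_mul1 : left_id ([::] : word X) word_mul.
Proof. by []. Qed.

Lemma letterVK : involutive letterV.
Proof. by case=> x s; rewrite /letterV /= negbK. Qed.

Lemma word_invK : involutive word_inv.
Proof. by move=> u; rewrite /word_inv map_rev revK mapK //; exact: letterVK. Qed.

Lemma word_invM : {morph word_inv : u v / word_mul u v >-> word_mul v u}.
Proof. by move=> u v; rewrite /word_inv /word_mul map_cat rev_cat. Qed.

HB.instance Definition _ := isStarMonoid.Build (word X)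
  word_mulA word_mul1 word_invK word_invM.

Definition word_gen (i : X) : word X := [:: (i, false)].

End Word.

(* Equality of words in the group < X | u = v for (u, v) in rels >. *)
Inductive pres_eq (X : choiceType) (rels : seq (word X * word X)) :
    word X -> word X -> Prop :=
| pres_eq_refl u : pres_eq rels u u
| pres_eq_sym u v : pres_eq rels u v -> pres_eq rels v u
| pres_eq_trans u v w :
    pres_eq rels u v -> pres_eq rels v w -> pres_eq rels u w
| pres_eq_mul u u' v v' :
    pres_eq rels u u' -> pres_eq rels v v' -> pres_eq rels (u * v) (u' * v')
| pres_eq_cancel l : pres_eq rels [:: l; letterV l] 1
| pres_eq_rel u v : (u, v) \in rels -> pres_eq rels u v.

Section Presentation.
Variables (X : choiceType) (rels : seq (word X * word X)).

Definition pres_eqb : rel (word X) := fun u v => `[< pres_eq rels u v >].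

Lemma pres_eqb_equiv : equiv_class_of pres_eqb.
Proof.
split=> [u|u v|v u w]; first by apply/asboolP; exact: pres_eq_refl.
  by apply/asboolP/asboolP; exact: pres_eq_sym.
by move=> /asboolP uv /asboolP vw; apply/asboolP; exact: pres_eq_trans uv vw.
Qed.

Canonical pres_equiv_rel := EquivRelPack pres_eqb_equiv.

Definition presented : Type := {eq_quot pres_equiv_rel}.

HB.instance Definition _ := Choice.on presented.
HB.instance Definition _ := Quotient.on presented.

Definition pres_pi (u : word X) : presented := \pi_presented u.

Lemma pres_piP u v : pres_pi u = pres_pi v <-> pres_eq rels u v.
Proof.
split; last by move=> uv; apply/eqmodP/asboolP.
by move=> /eqmodP/asboolP.
Qed.

Lemma pres_reprK g : pres_pi (repr g) = g.
Proof. exact: reprK. Qed.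

Lemma pres_eq_repr u : pres_eq rels (repr (pres_pi u)) u.
Proof. by apply/pres_piP; rewrite pres_reprK. Qed.

Lemma pres_eq_cancelV l : pres_eq rels [:: letterV l; l] 1.
Proof. by rewrite -{2}[l]letterVK; exact: pres_eq_cancel. Qed.

Lemma pres_eq_mulV (u : word X) : pres_eq rels (u * u^-1) 1.
Proof.
elim: u => [|l u]; first by move=> *; exact: pres_eq_refl.
rewrite -/(word X) in u *; move=> IHu.
have -> : (l :: u : word X) = ([:: l] : word X) * u by [].
have -> : ([:: l] : word X) * u * (([:: l] : word X) * u)^-1
    = ([:: l] : word X) * ((u * u^-1) * ([:: letterV l] : word X)).
  by rewrite invgM !mulgA.
apply: pres_eq_trans (pres_eq_cancel rels l).
apply: (pres_eq_mul (pres_eq_refl _ [:: l])).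
exact: (pres_eq_mul IHu (pres_eq_refl _ [:: letterV l])).
Qed.

Lemma pres_eq_inv (u v : word X) :
  pres_eq rels u v -> pres_eq rels u^-1 v^-1.
Proof.
move=> uv; apply: (pres_eq_trans (v := u^-1 * (v * v^-1))).
  apply: pres_eq_sym; rewrite -{2}[u^-1]mulg1.
  exact: pres_eq_mul (pres_eq_refl _ _) (pres_eq_mulV v).
rewrite mulgA -{2}[v^-1]mul1g; apply: pres_eq_mul (pres_eq_refl _ _).
apply: (pres_eq_trans (v := u^-1 * u)).
  exact: pres_eq_mul (pres_eq_refl _ _) (pres_eq_sym uv).
by rewrite -{2}[u]invgK; exact: pres_eq_mulV.
Qed.

Definition pres_one : presented := pres_pi 1.
Definition pres_mul (g h : presented) : presented :=
  pres_pi (repr g * repr h).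
Definition pres_inv (g : presented) : presented := pres_pi (repr g)^-1.

Lemma pres_piM u v : pres_pi (u * v) = pres_mul (pres_pi u) (pres_pi v).
Proof.
by apply/pres_piP/pres_eq_sym/pres_eq_mul; exact: pres_eq_repr.
Qed.

Lemma pres_piV u : pres_pi u^-1 = pres_inv (pres_pi u).
Proof. by apply/pres_piP/pres_eq_sym/pres_eq_inv/pres_eq_repr. Qed.

Lemma pres_mulA : associative pres_mul.
Proof.
move=> g h k; rewrite -[g]pres_reprK -[h]pres_reprK -[k]pres_reprK.
by rewrite -!pres_piM mulgA.
Qed.

Lemma pres_mul1g : left_id pres_one pres_mul.
Proof. by move=> g; rewrite -[g]pres_reprK -pres_piM mul1g. Qed.

Lemma pres_mulg1 : right_id pres_one pres_mul.
Proof. by move=> g; rewrite -[g]pres_reprK -pres_piM mulg1. Qed.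

Lemma pres_mulgV : right_inverse pres_one pres_inv pres_mul.
Proof.
move=> g; rewrite -[g]pres_reprK -pres_piV -pres_piM.
exact/pres_piP/pres_eq_mulV.
Qed.

Lemma pres_mulVg : left_inverse pres_one pres_inv pres_mul.
Proof.
move=> g; rewrite -[g]pres_reprK -pres_piV -pres_piM; apply/pres_piP.
by rewrite -{2}[repr g]invgK; exact: pres_eq_mulV.
Qed.

HB.instance Definition _ := isGroup.Build presented
  pres_mulA pres_mul1g pres_mulg1 pres_mulVg pres_mulgV.

Definition pres_gen (i : X) : presented := pres_pi (word_gen i).

End Presentation.

Lemma pres_pi_is_monoid_morphism (X : choiceType) (rels : seq (word X * word X)) :
  monoid_morphism (pres_pi rels).
Proof. by split=> // u v; exact: pres_piM. Qed.

HB.instance Definition _ (X : choiceType) (rels : seq (word X * word X)) :=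
  isUMagmaMorphism.Build (word X) (presented rels) (pres_pi rels)
    (pres_pi_is_monoid_morphism rels).

Section PresentedTheory.
Variables (X : choiceType) (rels : seq (word X * word X)).
Local Notation pi := (pres_pi rels).

Lemma pres_pi_rel u v : (u, v) \in rels -> pi u = pi v.
Proof. by move=> uv; apply/pres_piP/pres_eq_rel. Qed.

Lemma pres_pi_inv u : pi u^-1 = (pi u)^-1.
Proof. exact: pres_piV. Qed.

Lemma pres_pi_expgz u n : pi (expgz u n) = expgz (pi u) n.
Proof.
case: n => n; rewrite /expgz; first exact: gmulfXn.
by rewrite pres_pi_inv gmulfXn.
Qed.

Lemma pres_pi_conj u v : pi (u ^ v) = pi u ^ pi v.
Proof. by rewrite /conjg -pres_pi_inv !gmulfM. Qed.

End PresentedTheory.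

Section Lift.
Variables (X : choiceType) (H : groupType) (h : X -> H).

Definition letter_eval (l : X * bool) : H := if l.2 then (h l.1)^-1 else h l.1.
Definition word_eval (u : word X) : H := \prod_(l <- u) letter_eval l.

Lemma word_eval1 : word_eval 1 = 1.
Proof. exact: big_nil. Qed.

Lemma word_evalM : {morph word_eval : u v / u * v}.
Proof. by move=> u v; rewrite /word_eval [u * v]/(u ++ v) big_cat. Qed.

Variable rels : seq (word X * word X).
Hypothesis hrels : forall u v, (u, v) \in rels -> word_eval u = word_eval v.

Lemma pres_eq_eval u v : pres_eq rels u v -> word_eval u = word_eval v.
Proof.
elim=> {u v} [//|u v _ -> //|u v w _ -> _ -> //|u u' v v' _ E _ E'|[i s]|//].
  by rewrite !word_evalM E E'.
rewrite word_eval1 /word_eval big_cons big_seq1 /letter_eval /=.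
by case: s; rewrite (mulVg, mulgV).
Qed.

Definition pres_lift (g : presented rels) : H := word_eval (repr g).

Lemma pres_lift_pi u : pres_lift (pres_pi rels u) = word_eval u.
Proof. by apply: pres_eq_eval; exact: pres_eq_repr. Qed.

Lemma pres_liftM : {morph pres_lift : g k / g * k}.
Proof.
move=> g k; rewrite -[g]pres_reprK -[k]pres_reprK -gmulfM.
by rewrite !pres_lift_pi word_evalM.
Qed.

Lemma pres_lift_gen i : pres_lift (pres_gen rels i) = h i.
Proof. by rewrite pres_lift_pi /word_eval big_seq1. Qed.

End Lift.

Section GGroup.
Variables a b c d e f : int.

Let x : word 'I_3 := word_gen (inord 0).
Let y : word 'I_3 := word_gen (inord 1).
Let z : word 'I_3 := word_gen (inord 2).

Definition G_rels : seq (word 'I_3 * word 'I_3) :=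
  [:: (expgz x a ^ y, expgz x b);
      (expgz y c ^ z, expgz y d);
      (expgz z e ^ x, expgz z f)].

Definition Ggroup : groupType := presented G_rels.

Definition Gx : Ggroup := pres_gen G_rels (inord 0).
Definition Gy : Ggroup := pres_gen G_rels (inord 1).
Definition Gz : Ggroup := pres_gen G_rels (inord 2).

Lemma Gxy_rel : expgz Gx a ^ Gy = expgz Gx b.
Proof.
have /pres_pi_rel : (expgz x a ^ y, expgz x b) \in G_rels.
  by rewrite in_cons eqxx.
by rewrite pres_pi_conj !pres_pi_expgz.
Qed.

Lemma Gyz_rel : expgz Gy c ^ Gz = expgz Gy d.
Proof.
have /pres_pi_rel : (expgz y c ^ z, expgz y d) \in G_rels.
  by rewrite in_cons mem_head orbT.
by rewrite pres_pi_conj !pres_pi_expgz.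
Qed.

Lemma Gzx_rel : expgz Gz e ^ Gx = expgz Gz f.
Proof.
have /pres_pi_rel : (expgz z e ^ x, expgz z f) \in G_rels.
  by rewrite 2!in_cons mem_head !orbT.
by rewrite pres_pi_conj !pres_pi_expgz.
Qed.

End GGroup.

(* Main.v *)
From HB Require Import structures.
Require Import Defs.
From mathcomp Require Import all_boot all_order all_algebra all_fingroup.
From mathcomp Require Import all_solvable generic_quotient.

(** Call a group generated by [x, y, z] satisfying the three relations a
    triangle group.  Suppose first that [x, y, z] have finite order.  If
    [y ^+ n = 1], then conjugating [n] times by [y] turns [(x^a)^y = x^b] into
    [x^(a^n - b^n) = 1], so the order of [x] is prime to [a], whence [x^y] is a
    power of [x]: [y] normalises [<[x]>], and likewise [z] normalises [<[y]>]
    and [x] normalises [<[z]>].  Powers of [x], [y], [z] can then be moved past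
    each other, every element is of the form [x^i y^j z^k], and the group is
    finite.

    The key fact ([commg_vxy]) is about these three cyclic groups only.  Put
    [v = [~ z, y]], an element of [<[y]>].  Conjugating [z^y = z v] by [x]
    yields [[~ v, x] \in <[y]> <[z]>]; since [y] centralises the first factor
    and changes an element of the second by a factor in [<[y]>],
    [[~ w, y] \in <[y]>] for every power [w] of [[~ v, x]].  There are two
    consequences.

    - Orders are bounded ([triangle_order_bound]).  From [(y^c)^z = y^d] one
      gets [v^c = y^(c - d)], so with [n = |c - d|] the element
      [w = x^(b^n - a^n) = [~ x^(a^n), y^n]] is a power of [[~ v, x]]; then
      [w^(b - a) = [~ w^a, y]] is a power of [y], commutes with [y], and this
      forces [w^((b - a)^2) = 1].  The bound depends on [a, b, c, d] only, and
      it is not [0].  Hence adding to [G] the three relators that kill the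
      powers of [x], [y], [z] given by the bounds produces the universal
      quotient [Q].

    - [Q'] is generated by [[~ x, y]], [[~ y, z]] and [[~ z, x]]
      ([der1_three_cycles]), and the commutator [t] of the first two lies in
      [<[x]>] and in [<[y]>].  As [[~ z, t]] is a power of [t], it commutes with
      [x], hence [t] commutes with [[~ z, x]] ([double_commg_commutes]).  So
      [Q'] has class at most 2.

    Finally let some exponent be [1]; by the symmetries of the presentation
    [x^y = x^b] with [|b| > 1].  Then suitable powers [t] of [y] act on both [x]
    and a conjugate [x'] of [x] by a power of [z] as raising to distinct powers
    [q] and [p], while [x^-1 x'] is a power of [z] and so conjugates a power of
    [t] to a power of [t].  This writes a power of [t] as [x^i x'^j]; as it
    commutes with [t], some [x^u] with [u <> 0] equals some [x'^w]; conjugating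
    this by [t] gives [x^(u q) = x^(u p)], so [x] has finite order
    ([finite_order_power_pair]).  Then so do [z] and [y], and universality of
    [Q] provides an inverse of [G -> Q]. *)

Set Implicit Arguments.
Unset Strict Implicit.
Unset Printing Implicit Defensive.

Import GRing.Theory Num.Theory.
Local Open Scope group_scope.

Arguments expgz {G} g n%_R.

(** * Integer powers *)

Section IntegerPowers.
Variable G : groupType.
Implicit Types (g h : G) (m n : int).

Lemma expgzN g n : expgz g (- n) = (expgz g n)^-1.
Proof. by case: n => [[|n]|n] /=; rewrite ?invg1 ?invgK. Qed.

Lemma expgzV g n : expgz g^-1 n = (expgz g n)^-1.
Proof. by case: n => n /=; rewrite expVgn. Qed.

(** Writing exponents as differences of natural numbers avoids a discussion of
    signs in the proofs that they add and multiply. *)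
Lemma expgz_subn g (m n : nat) : expgz g (m%:Z - n%:Z) = g ^+ m * g ^- n.
Proof.
have sub_le i j : (i <= j)%N -> expgz g (j%:Z - i%:Z) = g ^+ j * g ^- i.
  by move=> le_ij; rewrite subzn //= expgnFr.
case/orP: (leq_total n m) => [/sub_le // | /sub_le le_mn].
by rewrite -opprB expgzN le_mn invgF.
Qed.

Lemma int_subn m : exists i j : nat, m = (i%:Z - j%:Z)%R.
Proof.
case: m => i; first by exists i, 0%N; rewrite subr0.
by exists 0%N, i.+1; rewrite sub0r NegzE.
Qed.

Lemma expgzD g m n : expgz g (m + n) = expgz g m * expgz g n.
Proof.
have [i [j ->]] := int_subn m; have [k [l ->]] := int_subn n.
rewrite addrACA -opprD -!PoszD !expgz_subn !expgnDr invgM -!mulgA.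
congr (_ * _).
have cVX s t : commute (g ^- s) (g ^+ t).
  exact/commute_sym/commuteV/commuteX2.
by rewrite [RHS](commuteM (cVX j k) (commuteV (cVX j l))) !mulgA.
Qed.

Lemma expgzB g m n : expgz g (m - n) = expgz g m * (expgz g n)^-1.
Proof. by rewrite expgzD expgzN. Qed.

Lemma expgzC g m n : expgz g m * expgz g n = expgz g n * expgz g m.
Proof. by rewrite -!expgzD addrC. Qed.

Lemma expgzM g m n : expgz g (m * n)%R = expgz (expgz g m) n.
Proof.
have natM i : expgz g (m * i%:Z)%R = expgz g m ^+ i.
  elim: i => [|i IHi]; first by rewrite mulr0.
  by rewrite expgS -IHi -expgzD -{2}[m]mulr1 -mulrDr -PoszD.
have [i [j ->]] := int_subn n.
have -> : (m * (i%:Z - j%:Z) = m * i%:Z - m * j%:Z)%R by rewrite mulrBr.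
by rewrite !expgzB !natM.
Qed.

Lemma expgzAC g m n : expgz (expgz g m) n = expgz (expgz g n) m.
Proof. by rewrite -!expgzM mulrC. Qed.

Lemma conj_expgz g h n : expgz g n ^ h = expgz (g ^ h) n.
Proof. by case: n => n /=; rewrite ?conjVg conjXg. Qed.

Lemma expgz1n n : expgz (1 : G) n = 1.
Proof. by case: n => n /=; rewrite expg1n ?invg1. Qed.

Lemma expgz_abs g n : (expgz g n = 1) <-> (g ^+ `|n|%N = 1).
Proof.
case: n => n //=; rewrite /expgz; split=> [/(congr1 inv)|->]; last exact: invg1.
by rewrite invgK invg1.
Qed.

Lemma expgzMl g h n : commute g h -> expgz (g * h) n = expgz g n * expgz h n.
Proof.
move=> cgh; case: n => n; rewrite /expgz expgMn //.
by rewrite (commuteX2 n.+1 n.+1 cgh) invgM.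
Qed.

End IntegerPowers.

(** * Relations and finite orders *)

Section Orders.
Variable G : groupType.
Implicit Types (x y : G) (a b c d : int).

Lemma conj_expgz_iter x y a b n :
    expgz x a ^ y = expgz x b ->
  expgz x (a ^+ n)%R ^ (y ^+ n) = expgz x (b ^+ n)%R.
Proof.
move=> xy; elim: n => [|n IHn]; first by rewrite conjg1.
rewrite exprSr expgzM expgSr conjgM conj_expgz IHn expgzAC conj_expgz xy.
by rewrite -expgzM -exprS.
Qed.

(** Conjugation by [y ^+ n] is trivial, but replaces the exponent [a ^+ n] by
    [b ^+ n]. *)
Lemma expgz_acting_order x y a b n :
    expgz x a ^ y = expgz x b -> y ^+ n = 1 ->
  expgz x (a ^+ n - b ^+ n) = 1.
Proof.
move=> /conj_expgz_iter-/(_ n) + yn1; rewrite yn1 conjg1 => xab.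
by rewrite expgzB xab mulgV.
Qed.

Lemma finite_orderz x n : n != 0%R -> expgz x n = 1 -> finite_order x.
Proof. by move=> n0 /expgz_abs xn; exists `|n|%N; rewrite ?absz_gt0. Qed.

End Orders.

(** * Finite order of the generators when some exponent is 1 *)

Section UnitExponent.
Variable G : groupType.
Implicit Types (x y z t : G) (a b c d e f : int).

Lemma finite_orderJ x y : finite_order (x ^ y) -> finite_order x.
Proof.
case=> n n0 xyn; exists n => //; apply: (@conjg_inj _ y).
by rewrite conjXg xyn conj1g.
Qed.

(** Expanding [t ^+ m] conjugated by [x^-1 * x'] gives
    [t ^+ (m - n) = x'^-1 x^(1 - q^m) x'^(p^m)], and moving [x'^-1] to the
    right across the power of [t] produces a power of [x] times a power of
    [x']. *)
Lemma finite_order_power_pair x x' t (p q : int) (m n : nat) :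
    x ^ t = expgz x q -> x' ^ t = expgz x' p ->
    (t ^+ m) ^ (x^-1 * x') = t ^+ n ->
    (n <= m)%N -> (0 < m)%N -> (1 < `|q|)%N -> p != q ->
  finite_order x.
Proof.
move=> xt x't tmn le_nm m0 q1 pq.
have iter g (r : int) k :
    g ^ t = expgz g r -> g ^ (t ^+ k) = expgz g (r ^+ k)%R.
  move=> gt; have: expgz g 1 ^ t = expgz g r by rewrite /= gt.
  by move=> /conj_expgz_iter-/(_ k); rewrite expr1n.
pose i := (1 - q ^+ m)%R; pose j := (p ^+ m - p ^+ (m - n))%R.
have tE : t ^+ (m - n) = (x^-1 * x')^-1 * (x^-1 * x') ^ (t ^+ m).
  move: (_ * x') tmn => u tmn.
  apply: (@mulgI _ (t ^+ n)); rewrite -expgnDr subnKC // -[in RHS]tmn /conjg.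
  by rewrite !mulgA !mulgK mulVg mul1g.
rewrite conjMg conjVg (iter _ _ _ xt) (iter _ _ _ x't) invgM invgK in tE.
have{}tE : t ^+ (m - n) = expgz x i * expgz x' j.
  apply: (@mulIg _ (expgz x' (p ^+ (m - n))%R)).
  rewrite -mulgA -expgzD subrK -(iter _ _ _ x't) -conjgC tE /i expgzB.
  by rewrite !mulgA mulgV mul1g.
have absX k : (0 < k)%N -> (1 - q ^+ k != 0)%R.
  move=> k0; rewrite subr_eq0; apply/eqP => /(congr1 absz) qk1.
  have: (`|q| ^ 1 <= `|q| ^ k)%N by rewrite leq_pexp2l // ltnW.
  by rewrite expn1 -abszX -qk1 leqNgt q1.
have i0 : (i != 0)%R by exact: absX.
clearbody i j.
(* Conjugation by [t] fixes [t ^+ (m - n)], which is a product of a power of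
   [x] and a power of [x']: two powers of [x] and [x'] coincide. *)
have eqX : expgz x (i * (1 - q)) = expgz x' (j * (p - 1)).
  have: (t ^+ (m - n)) ^ t = t ^+ (m - n) by rewrite conjXg conjgE mulKg.
  rewrite {}tE conjMg !conj_expgz xt x't -!expgzM => xx'.
  rewrite !mulrBr !mulr1 (mulrC i) (mulrC j) [(i - _)%R]addrC !expgzD !expgzN.
  by apply: (@mulgI _ (expgz x (q * i))); rewrite mulVKg mulgA xx' mulgK.
(* Conjugating this equality by [t] multiplies one exponent by [q] and the
   other by [p]. *)
have xN : expgz x (i * (1 - q) * (q - p)) = 1.
  have : expgz x (i * (1 - q)) ^ t = expgz x' (j * (p - 1)) ^ t by rewrite eqX.
  rewrite !conj_expgz xt x't -!expgzM.
  rewrite (mulrC p) (expgzM x') -eqX -expgzM (mulrC q) => xqp.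
  by rewrite mulrBr expgzB xqp mulgV.
apply: finite_orderz xN; rewrite !mulf_eq0 !negb_or i0 (absX 1%N) //=.
by rewrite subr_eq0 eq_sym.
Qed.

(** Even exponents make all the powers of [c] and [d] below natural numbers,
    whatever the signs. *)
Lemma even_exprz a n : ~~ odd n -> (a ^+ n)%R = ((`|a| ^ n)%N : int).
Proof. by move=> en; rewrite -abszX gez0_abs // exprn_even_ge0. Qed.

(** The pair is [x] and its conjugate by [z ^+ k], acted upon by [y ^+ r]: for
    [k] a multiple of [e], [x^-1 x'] is a power of [z], which conjugates some
    power of [y ^+ r] to another one.  If this raises the exponent, [x] and
    [x'] exchange their roles. *)
Lemma finite_order_unit_exponent x y z b c d e f :
    x ^ y = expgz x b -> expgz y c ^ z = expgz y d ->
    expgz z e ^ x = expgz z f ->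
    (1 < `|b|)%N -> c != 0 -> d != 0 -> e != 0 -> `|c|%N != `|d|%N ->
  finite_order x.
Proof.
move=> xy yz zx b1 c0 d0 e0 cd.
(* Up to sign, [k] and [l] are [2 e] and [2 f]. *)
pose k := (`|e| * 2)%N; pose l := (f * (sgz e * 2))%R.
have {}zx : (z ^+ k) ^ x = expgz z l.
  rewrite /l expgzM -zx -conj_expgz -expgzM mulrA [(e * _)%R]mulrC.
  by rewrite -abszEsg.
have k_even : ~~ odd k by rewrite /k muln2 odd_double.
have pow_gt0 (i : int) m : i != 0 -> (0 < `|i| ^ m)%N.
  by move=> i0; rewrite expn_gt0 absz_gt0 i0.
have xyn n : x ^ (y ^+ n) = expgz x (b ^+ n).
  have: expgz x 1 ^ y = expgz x b by rewrite /= xy.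
  by move=> /conj_expgz_iter-/(_ n); rewrite expr1n.
have b_inj i j : (b ^+ i == b ^+ j)%R -> i = j.
  move=> /eqP/(congr1 absz); rewrite !abszX => /eqP.
  by rewrite eqn_exp2l // => /eqP.
pose r := (`|d| ^ k)%N; pose s := (`|c| ^ k)%N.
have yzk : (y ^+ s) ^ (z ^+ k) = y ^+ r.
  by have := conj_expgz_iter k yz; rewrite !even_exprz.
pose x' := x ^ (z ^+ k); pose t := y ^+ r.
have x't : x' ^ t = expgz x' (b ^+ s).
  by rewrite /x' /t -yzk -conjgM -conjgC conjgM xyn conj_expgz.
have xx' : x^-1 * x' = expgz z (k%:Z - l).
  rewrite addrC expgzD expgzN -zx /x' /conjg.
  by rewrite !invgM invgK !mulgA.
have w_even : ~~ odd `|(k%:Z - l)%R|.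
  by rewrite /k /l PoszM mulrA -mulrBl abszM oddM andbF.
have [m [n [m0 n0 ymn]]] : exists m n : nat,
    [/\ (0 < m)%N, (0 < n)%N & (y ^+ m) ^ expgz z (k%:Z - l) = y ^+ n].
  move: (k%:Z - l)%R w_even => [w|w] w_even.
    exists (`|c| ^ w)%N, (`|d| ^ w)%N; split; rewrite ?pow_gt0 //.
    by have := conj_expgz_iter w yz; rewrite !even_exprz.
  exists (`|d| ^ w.+1)%N, (`|c| ^ w.+1)%N; split; rewrite ?pow_gt0 //.
  have := conj_expgz_iter w.+1 yz; rewrite !even_exprz //= => <-.
  by rewrite conjgK.
have tmn : (t ^+ m) ^ (x^-1 * x') = t ^+ n.
  by rewrite xx' /t -!expgnA !(mulnC r) !expgnA conjXg ymn.
have rs : r != s by rewrite eqn_exp2r ?muln_gt0 ?absz_gt0 ?e0 // eq_sym.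
have bk i (i0 : (0 < i)%N) : (1 < `|(b ^+ i)%R|)%N.
  by rewrite abszX -(exp1n i) ltn_exp2r.
have pq : (b ^+ s != b ^+ r)%R by apply: contraNneq rs => /eqP/b_inj->.
have [le_nm|/ltnW le_mn] := leqP n m.
  by apply: (finite_order_power_pair (xyn r) x't tmn); rewrite ?bk ?pow_gt0.
apply: (@finite_orderJ _ (z ^+ k)).
apply: (finite_order_power_pair x't (xyn r) _ le_mn);
  rewrite ?bk ?pow_gt0 // 1?eq_sym //.
by rewrite -[x'^-1 * x]invgK invgM invgK -tmn conjgK.
Qed.

End UnitExponent.

(** * Triangles of relations *)

(** The defining relations of [Ggroup], read in an arbitrary group. *)
Definition triangle (G : groupType) (a b c d e f : int) (x y z : G) : Prop :=
  [/\ expgz x a ^ y = expgz x b,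
      expgz y c ^ z = expgz y d &
      expgz z e ^ x = expgz z f].

Definition admissible (a b : int) : Prop :=
  [/\ a != 0, b != 0, gcdz a b = 1%R & `|a|%N != `|b|%N].

Section Triangles.
Variable G : groupType.
Implicit Types (x y z : G) (a b c d e f : int).

Lemma triangle_rot a b c d e f x y z :
  triangle a b c d e f x y z -> triangle c d e f a b y z x.
Proof. by case. Qed.

(** Inverting [y] exchanges [a] and [b] without affecting the other two
    relations. *)
Lemma triangle_flip a b c d e f x y z :
  triangle a b c d e f x y z -> triangle b a c d e f x y^-1 z.
Proof.
by case=> xy yz zx; split=> //; rewrite ?expgzV -?xy ?conjgK // conjVg yz.
Qed.

Lemma admissible_sym a b : admissible a b -> admissible b a.
Proof. by case=> a0 b0 ab abs; split; rewrite // 1?gcdzC 1?eq_sym. Qed.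

Lemma admissible_subX a b n : admissible a b -> (0 < n)%N ->
  (a ^+ n - b ^+ n != 0)%R.
Proof.
case=> _ _ _ ab n0; rewrite subr_eq0; apply: contraNneq ab => /(congr1 absz).
by rewrite !abszX => /eqP; rewrite eqn_exp2r.
Qed.

Lemma finite_order_acted x y a b : admissible a b ->
  expgz x a ^ y = expgz x b -> finite_order y -> finite_order x.
Proof.
move=> ab xy [n n0 yn]; apply: finite_orderz (expgz_acting_order xy yn).
exact: admissible_subX.
Qed.

Definition all_finite_order x y z :=
  [/\ finite_order x, finite_order y & finite_order z].

(** Finiteness of orders propagates along the triangle against the action:
    from [x] to [z], which [x] acts upon, then from [z] to [y]. *)
Lemma triangle_finite_order a b c d e f x y z :
    admissible a b -> admissible c d -> admissible e f ->
    triangle a b c d e f x y z -> finite_order x ->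
  all_finite_order x y z.
Proof.
move=> ab cd ef [xy yz zx] fx.
have fz := finite_order_acted ef zx fx.
by split=> //; exact: finite_order_acted yz fz.
Qed.

Lemma triangle_exponent1 b c d e f x y z :
    admissible 1 b -> admissible c d -> admissible e f ->
    triangle 1 b c d e f x y z ->
  all_finite_order x y z.
Proof.
move=> ab cd ef T; apply: (triangle_finite_order ab cd ef T).
case: T => xy yz zx; case: ab cd ef => _ b0 _ b1 [c0 d0 _ ?] [e0 _ _ _].
apply: (finite_order_unit_exponent xy yz zx) => //.
by rewrite ltn_neqAle b1 absz_gt0.
Qed.

Lemma triangle_unit_exponent_ab a b c d e f x y z :
    admissible a b -> admissible c d -> admissible e f ->
    triangle a b c d e f x y z -> (1%R == a) || (1%R == b) ->
  all_finite_order x y z.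
Proof.
move=> ab cd ef T /orP[] /eqP a1.
  by rewrite -a1 in ab T *; exact: triangle_exponent1 T.
have /triangle_exponent1 : triangle 1 a c d e f x y^-1 z.
  by rewrite a1; exact: triangle_flip.
case=> // [|fx [n n0 yn] fz]; first by rewrite a1; exact: admissible_sym.
by split=> //; exists n => //; apply: invg_inj; rewrite -expVgn yn invg1.
Qed.

Lemma triangle_unit_exponent a b c d e f x y z :
    admissible a b -> admissible c d -> admissible e f ->
    triangle a b c d e f x y z -> 1%R \in [:: a; b; c; d; e; f] ->
  all_finite_order x y z.
Proof.
move=> ab cd ef T; rewrite !inE => u.
have /or3P[] : [|| (1%R == a) || (1%R == b), (1%R == c) || (1%R == d)
    | (1%R == e) || (1%R == f)] by rewrite -!orbA.
- exact: (triangle_unit_exponent_ab ab cd ef T).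
- by case/(triangle_unit_exponent_ab cd ef ab (triangle_rot T)).
by case/(triangle_unit_exponent_ab ef ab cd (triangle_rot (triangle_rot T))).
Qed.

End Triangles.

(** * Three cyclic groups normalising each other in a circle *)

Section CommutatorLemmas.
Variable gT : finGroupType.
Implicit Types (x y z v w : gT).

Lemma memJ_cycle x y g : y \in 'N(<[x]>) -> g \in <[x]> -> g ^ y \in <[x]>.
Proof. by move=> nxy; rewrite memJ_norm. Qed.

Lemma memR_cycle x y g : y \in 'N(<[x]>) -> g \in <[x]> -> [~ g, y] \in <[x]>.
Proof. by move=> nxy gx; rewrite commgEl groupM ?groupV ?memJ_cycle. Qed.

Lemma memR_cycler x y g : y \in 'N(<[x]>) -> g \in <[x]> -> [~ y, g] \in <[x]>.
Proof. by move=> nxy gx; rewrite -invgR groupV memR_cycle. Qed.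

Lemma commute_cycle x g h : g \in <[x]> -> h \in <[x]> -> commute g h.
Proof. by move=> gx hx; apply: (centsP (cycle_abelian x)). Qed.

(** A subgroup of a cyclic group is characteristic. *)
Lemma norm_subcycle x y g : y \in 'N(<[x]>) -> g \in <[x]> -> y \in 'N(<[g]>).
Proof.
move=> nxy gx; have: <[g]> \char <[x]>.
  by rewrite sub_cyclic_char ?cycle_cyclic ?cycle_subG.
by move/char_norms/subsetP; apply.
Qed.

Lemma norm_cycle_mem x y h : y \in 'N(<[x]>) -> h \in <[y]> -> h \in 'N(<[x]>).
Proof. by move=> nxy; apply/subsetP; rewrite cycle_subG. Qed.

(** Power endomorphisms of a cyclic group form a commutative ring: both sides
    are [x] to the power [(y - 1)(v - 1)]. *)
Lemma commg_swap x y v : y \in 'N(<[x]>) -> v \in 'N(<[x]>) -> commute y v ->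
  [~ x, y, v] = [~ x, v, y].
Proof.
move=> nxy nxv cyv; have J := memJ_cycle; have C := @commute_cycle x.
have xx := cycle_id x.
rewrite (commgEl _ v) (commgEl x y) (commgEl x v) (commgEl _ y).
rewrite !(conjMg x^-1) !conjVg.
rewrite !(invgM x^-1) !invgK -!conjgM cyv [LHS]mulgA [RHS]mulgA; congr (_ * _).
have [xyV xvV] : (x ^ y)^-1 \in <[x]> /\ (x ^ v)^-1 \in <[x]>.
  by rewrite !groupV !J.
by rewrite -mulgA (C _ _ xx xvV) mulgA (C _ _ xyV xvV) -!mulgA (C _ _ xyV xx).
Qed.

Lemma commg_expr x y g : y \in 'N(<[x]>) -> g \in <[y]> ->
  [~ x, g] \in <[ [~ x, y] ]>.
Proof.
move=> nxy /cycleP[n ->]; elim: n => [|n IHn]; first by rewrite commg1.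
rewrite expgSr; have ->: [~ x, y ^+ n * y] = [~ x, y] * [~ x, y ^+ n] ^ y.
  by rewrite /commg /conjg !invgM !mulgA !mulgK.
rewrite groupM ?cycle_id // memJ_norm // (norm_subcycle nxy) //.
exact/memR_cycle/cycle_id.
Qed.

Lemma commg_expl x y g : y \in 'N(<[x]>) -> g \in <[x]> ->
  [~ g, y] \in <[ [~ x, y] ]>.
Proof.
move=> nxy /cycleP[n ->]; apply/cycleP; exists n.
have xJ: x ^ y \in <[x]> by rewrite memJ_cycle ?cycle_id.
have c : commute x^-1 (x ^ y).
  by apply: (@commute_cycle x); rewrite ?groupV ?cycle_id.
by rewrite !commgEl conjXg (expgMn n c) expVgn.
Qed.

End CommutatorLemmas.

Section ThreeCycles.
Variable gT : finGroupType.
Variables x y z : gT.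
Hypotheses (nxy : y \in 'N(<[x]>)) (nyz : z \in 'N(<[y]>)).
Hypothesis (nzx : x \in 'N(<[z]>)).

Let v := [~ z, y].
Let xx := cycle_id x.
Let yy := cycle_id y.
Let zz := cycle_id z.

Lemma commg_zy_mem : v \in <[y]>.
Proof. exact: memR_cycler. Qed.

Lemma commg_vx_mem : [~ v, x] \in <[x]>.
Proof. by apply: memR_cycler => //; apply: norm_cycle_mem commg_zy_mem. Qed.

(** Conjugate [z = z ^ y^-1 * v] by [x]: as [y^-1 x = x^y y^-1], the factor
    [z ^ y^-1] becomes the conjugate by [y^-1] of a power [k] of [z], which
    differs from [k] by an element of [<[y]>]. *)
Lemma commg_vx_yz :
  exists2 g, g \in <[y]> & exists2 k, k \in <[z]> & [~ v, x] = g * k.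
Proof.
have vy : v ^ y^-1 = v.
  apply/conjg_fixP/commgP/commuteV.
  exact: commute_cycle commg_zy_mem yy.
have zE : z = z ^ y^-1 * v.
  by rewrite -[in RHS]vy -conjMg /v commgEl mulKVg conjgK.
pose x' := x ^ y.
have x'x : x' \in <[x]> by rewrite memJ_cycle.
have yx : y^-1 * x = x' * y^-1 by rewrite /x' /conjg !mulgA mulgK.
pose k := z ^ x'.
have kz : k \in <[z]> by rewrite memJ_cycle //; apply: norm_cycle_mem x'x.
have zx : z ^ x = k * [~ k, y^-1] * v ^ x.
  by rewrite {1}zE conjMg -conjgM yx conjgM commgEl mulKVg.
have uy : [~ k, y^-1] \in <[y]>.
  by rewrite memR_cycler ?groupV //; apply: norm_cycle_mem kz.
clearbody k.
exists (v^-1 * [~ k, y^-1]^-1); first by rewrite groupM ?groupV ?commg_zy_mem.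
exists (k^-1 * z ^ x).
  by apply: groupM; [rewrite groupV | exact: memJ_cycle].
rewrite zx (commgEl v); move: (v ^ x) [~ k, _] => w u.
by rewrite -!mulgA !mulKg.
Qed.

(** [y] fixes [g] and moves [k] within [k * <[y]>], where [[~ v, x] = g * k]. *)
Lemma commg_vxy w : w \in <[ [~ v, x] ]> -> [~ w, y] \in <[y]>.
Proof.
have [g gy [k kz vx]] := commg_vx_yz.
have vxy : [~ [~ v, x], y] \in <[y]>.
  rewrite commgEl vx conjMg invgM.
  have -> : g ^ y = g by apply/conjg_fixP/commgP; exact: commute_cycle yy.
  rewrite -mulgA mulKg -commgEl memR_cycler //; exact: norm_cycle_mem kz.
move=> wvx; have nvxy : y \in 'N(<[ [~ v, x] ]>) :=
  norm_subcycle nxy commg_vx_mem.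
have := commg_expl nvxy wvx; apply/subsetP.
by rewrite cycle_subG.
Qed.

Let t := [~ [~ x, y], [~ y, z]].

Lemma double_commg_x : t \in <[x]>.
Proof.
apply: memR_cycle; last exact: memR_cycle.
by apply: norm_cycle_mem nxy _; exact: memR_cycle.
Qed.

(** By [commg_swap], [t] is also the commutator with [y] of [[~ x, v^-1]], a
    power of [[~ v, x]], so [commg_vxy] applies to it. *)
Lemma double_commg_y : t \in <[y]>.
Proof.
have vyz : [~ y, z] = v^-1 by rewrite /v invgR.
have vy : v^-1 \in <[y]> by rewrite groupV commg_zy_mem.
have nxv : v^-1 \in 'N(<[x]>) by apply: norm_cycle_mem vy.
rewrite /t vyz commg_swap //; last exact: commute_cycle vy.
apply: commg_vxy; rewrite -cycleV (invgR v); apply: commg_expr => //.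
- by rewrite -groupV.
- by rewrite groupV cycle_id.
Qed.

(** Only the last commutation is not immediate.  By [commg_swap] it says that
    [[~ z, t]] commutes with [x]; but [t \in <[y]>], so [[~ z, t]] is a power of
    [t], and [t \in <[x]>]. *)
Lemma double_commg_commutes :
  [/\ commute t [~ x, y], commute t [~ y, z] & commute t [~ z, x]].
Proof.
split; first exact: commute_cycle double_commg_x (memR_cycle nxy xx).
  exact: commute_cycle double_commg_y (memR_cycle nyz yy).
have nzt : t \in 'N(<[z]>) by apply: norm_cycle_mem double_commg_x.
apply/commute_sym/commgP; rewrite (commg_swap nzx nzt); last first.
  exact: commute_cycle xx double_commg_x.
apply/commgP; apply: commute_cycle xx.
have: [~ z, t] \in <[t]>.
  apply: memR_cycler (cycle_id t); exact: norm_subcycle nyz double_commg_y.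
by apply/subsetP; rewrite cycle_subG double_commg_x.
Qed.

End ThreeCycles.

Section Derived.
Variable gT : finGroupType.
Implicit Types (x y z g h : gT) (A : {set gT}).

Lemma der1_gen_sub A (K : {group gT}) :
    A \subset 'N(K) -> {in A &, forall g h, [~ g, h] \in K} ->
  <<A>>^`(1) \subset K.
Proof.
move=> nKA cA; apply: der1_min; first by rewrite gen_subG.
rewrite quotient_gen // abelian_gen; apply/centsP=> _ /morphimP[g ng gA ->].
move=> _ /morphimP[h nh hA ->]; apply/commgP.
by rewrite -morphR //= coset_id // cA.
Qed.

Definition comm_gens x y z : {set gT} := [set [~ x, y]; [~ y, z]; [~ z, x]].

Lemma comm_gens_rot x y z : comm_gens y z x = comm_gens x y z.
Proof. by apply/setP=> g; rewrite !inE; do 3!case: eqP. Qed.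

(** [x] centralises [[~ x, y]], normalises the subgroup of [<[z]>] generated
    by [[~ z, x]], and moves [[~ y, z] \in <[y]>] by a power of [[~ x, y]]. *)
Lemma norm_comm_gens x y z :
    y \in 'N(<[x]>) -> z \in 'N(<[y]>) -> x \in 'N(<[z]>) ->
  x \in 'N(<<comm_gens x y z>>).
Proof.
move=> nxy nyz nzx; set S := <<_>>.
have [Xs Ys Zs] : [/\ [~ x, y] \in S, [~ y, z] \in S & [~ z, x] \in S].
  by split; apply: mem_gen; rewrite !inE eqxx ?orbT.
rewrite inE -genJ gen_subG; apply/subsetP=> _ /imsetP[g + ->].
rewrite !inE -orbA => /or3P[] /eqP->.
- suff -> : [~ x, y] ^ x = [~ x, y] by [].
  apply/conjg_fixP/commgP; apply: commute_cycle (memR_cycle nxy _) _;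
    exact: cycle_id.
- rewrite (_ : [~ y, z] ^ x = [~ y, z] * [~ x, [~ y, z]]^-1); last first.
    by rewrite invgR commgEl mulVKg.
  rewrite groupMl // groupV; have: [~ x, [~ y, z]] \in <[ [~ x, y] ]>.
    apply: commg_expr => //; exact: memR_cycle nyz (cycle_id y).
  by apply/subsetP; rewrite cycle_subG.
have: [~ z, x] ^ x \in <[ [~ z, x] ]>.
  rewrite memJ_norm ?cycle_id //; apply: (norm_subcycle nzx).
  exact: memR_cycle nzx (cycle_id z).
by apply/subsetP; rewrite cycle_subG.
Qed.

Lemma commg_comm_central x y z :
    y \in 'N(<[x]>) -> z \in 'N(<[y]>) -> x \in 'N(<[z]>) ->
  [~ [~ x, y], [~ y, z]] \in 'Z(<<comm_gens x y z>>).
Proof.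
move=> nxy nyz nzx; have [cX cY cZ] := double_commg_commutes nxy nyz nzx.
rewrite inE groupR ?mem_gen ?inE ?eqxx ?orbT //= cent_gen.
apply/centP=> g; rewrite !inE -orbA => /or3P[] /eqP-> //.
Qed.

Lemma der1_three_cycles x y z :
    y \in 'N(<[x]>) -> z \in 'N(<[y]>) -> x \in 'N(<[z]>) ->
  <<[set x; y; z]>>^`(1) = <<comm_gens x y z>>.
Proof.
move=> nxy nyz nzx; apply/eqP; rewrite eqEsubset; apply/andP; split.
  have [Xs Ys Zs] : [/\ [~ x, y] \in <<comm_gens x y z>>,
      [~ y, z] \in <<comm_gens x y z>> & [~ z, x] \in <<comm_gens x y z>>].
    by split; apply: mem_gen; rewrite !inE eqxx ?orbT.
  apply: der1_gen_sub => [|g h].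
    apply/subsetP=> g /setUP[/set2P[]|/set1P] ->.
    - exact: norm_comm_gens.
    - by rewrite -comm_gens_rot norm_comm_gens.
    by rewrite -2!comm_gens_rot norm_comm_gens.
  rewrite !inE -!orbA => /or3P[] /eqP-> /or3P[] /eqP->;
    by rewrite ?commgg // -groupV invgR.
rewrite gen_subG; apply/subsetP=> g; rewrite !inE -orbA.
by case/or3P=> /eqP->; rewrite mem_commg ?mem_gen // !inE eqxx ?orbT.
Qed.

Lemma nil_class_three_cycles x y z :
    y \in 'N(<[x]>) -> z \in 'N(<[y]>) -> x \in 'N(<[z]>) ->
  (nil_class <<[set x; y; z]>>^`(1) <= 2)%N.
Proof.
move=> nxy nyz nzx; rewrite der1_three_cycles // nil_class2.
apply: der1_gen_sub => [|g h].
  apply: (subset_trans (subset_gen _)); exact/normal_norm/center_normal.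
have XY := commg_comm_central nxy nyz nzx.
have YZ := commg_comm_central nyz nzx nxy; rewrite comm_gens_rot in YZ.
have ZX := commg_comm_central nzx nxy nyz; rewrite 2!comm_gens_rot in ZX.
case/setUP=> [/set2P[]|/set1P] -> /setUP[/set2P[]|/set1P] ->;
    by rewrite ?commgg // -groupV invgR.
Qed.

End Derived.

(** * Bounding the orders of the generators *)

Section PowerConjugation.
Variable G : groupType.
Implicit Types (x y z : G) (a b : int).

Lemma coprimez_subX a b n : gcdz a b = 1%R -> (0 < n)%N ->
  coprimez a (a ^+ n - b ^+ n).
Proof.
case: n => // n ab _; rewrite exprS /coprimez mulrC gcdzMDl gcdzN.
rewrite -/(coprimez _ _).
by rewrite coprimezXr // /coprimez ab.
Qed.

(** The order of [x] divides [a ^+ n - b ^+ n], which is prime to [a]: so [x] is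
    a power of [x^a]. *)
Lemma conj_is_power x y a b : gcdz a b = 1%R ->
    expgz x a ^ y = expgz x b -> finite_order y ->
  exists i, x ^ y = expgz x i.
Proof.
move=> ab xy [n n0 yn]; have xk := expgz_acting_order xy yn.
have /coprimezP[[u w] /= uw] := coprimez_subX ab n0.
exists (b * u)%R; have {1}-> : x = expgz (expgz x a) u.
  rewrite -expgzM -[LHS]/(expgz x 1) -uw expgzD mulrC [(w * _)%R]mulrC.
  by rewrite (expgzM x (_ - _)) xk expgz1n mulg1.
by rewrite conj_expgz xy -expgzM.
Qed.

End PowerConjugation.

(** A multiple of the order of [x] in every finite triangle group; for the
    orders of [y] and [z] the exponents are rotated. *)
Definition order_bound (a b c d : int) : int :=
  let n := `|c - d|%N in ((b ^+ n - a ^+ n) * (b - a) ^+ 2)%R.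

Lemma order_bound_neq0 a b c d : admissible a b -> admissible c d ->
  order_bound a b c d != 0.
Proof.
move=> ab [_ _ _ cd]; have ba := admissible_sym ab.
rewrite mulf_neq0 ?expf_neq0 ?(admissible_subX (n := 1) ba) //.
apply: admissible_subX ba _; rewrite absz_gt0 subr_eq0.
by apply: contraNneq cd => ->.
Qed.

Section FiniteTriangle.
Variable gT : finGroupType.
Implicit Types (x y z : gT) (a b c d e f : int).

Lemma mem_expgz (K : {group gT}) g n : g \in K -> expgz g n \in K.
Proof. by case: n => n gK /=; rewrite ?groupV groupX. Qed.

Lemma finite_order_fin x : finite_order x.
Proof. by exists #[x]; rewrite ?order_gt0 ?expg_order. Qed.

Lemma relation_norm x y a b : gcdz a b = 1%R ->
  expgz x a ^ y = expgz x b -> y \in 'N(<[x]>).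
Proof.
move=> ab xy; have [i xyi] := conj_is_power ab xy (finite_order_fin y).
rewrite -cycle_subG norms_cycle xyi; exact/mem_expgz/cycle_id.
Qed.

Lemma triangle_norms a b c d e f x y z :
    gcdz a b = 1%R -> gcdz c d = 1%R -> gcdz e f = 1%R ->
    triangle a b c d e f x y z ->
  [/\ y \in 'N(<[x]>), z \in 'N(<[y]>) & x \in 'N(<[z]>)].
Proof.
by move=> ab cd ef [xy yz zx]; split; [exact: relation_norm xy
  | exact: relation_norm yz | exact: relation_norm zx].
Qed.

(** Let [v = [~ z, y]] and [w = x^(b^n - a^n)] with [n = |c - d|].  Since [y^n]
    is a power of [v] and [w = [~ x^(a^n), y^n]], [commg_vxy] makes
    [w^(b - a) = [~ w^a, y]] commute with [y]; as [y] also carries [w^a] to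
    [w^b], it follows that [w^((b - a) a) = w^((b - a) b)]. *)
Lemma triangle_order_bound a b c d e f x y z :
    gcdz a b = 1%R -> gcdz c d = 1%R -> gcdz e f = 1%R ->
    triangle a b c d e f x y z ->
  expgz x (order_bound a b c d) = 1.
Proof.
move=> ab cd ef T; have [nxy nyz nzx] := triangle_norms ab cd ef T.
have [xy yz _] := T; pose v := [~ z, y]; pose n := `|c - d|%N.
have vy : v \in <[y]> := commg_zy_mem nyz.
have nxv : v \in 'N(<[x]>) := norm_cycle_mem nxy vy.
have vc : expgz v c = expgz y (c - d).
  have cVy : commute (y^-1 ^ z) y.
    apply: (@commute_cycle _ y); rewrite ?cycle_id //.
    by rewrite memJ_cycle ?groupV ?cycle_id.
  rewrite /v commgEr expgzMl // -conj_expgz expgzV conjVg yz.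
  by rewrite addrC expgzD expgzN.
have yn : y ^+ n \in <[v]>.
  have: expgz y (c - d) \in <[v]> by rewrite -vc; apply/mem_expgz/cycle_id.
  rewrite /n; case: (c - d)%R => // k /=; by rewrite groupV.
pose w := expgz x (b ^+ n - a ^+ n).
have wE : w = [~ expgz x (a ^+ n), y ^+ n].
  by rewrite commgEl (conj_expgz_iter n xy) /w addrC expgzD expgzN.
have wvx : w \in <[ [~ v, x] ]>.
  have nxyn : y ^+ n \in 'N(<[x]>) by rewrite groupX.
  have := commg_expr nxv yn; rewrite -cycle_subG => /subsetP sub.
  rewrite -(invgR x v) cycleV wE; apply: sub.
  by apply: commg_expl => //; exact/mem_expgz/cycle_id.
have wJ : expgz w a ^ y = expgz w b.
  by rewrite /w !(expgzAC x (b ^+ n - a ^+ n)) conj_expgz xy.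
have wy : expgz w (b - a) \in <[y]>.
  have := commg_vxy nxy nyz nzx (mem_expgz a wvx).
  by rewrite commgEl wJ addrC expgzD expgzN.
have wyJ : expgz w (b - a) ^ y = expgz w (b - a).
  by apply/conjg_fixP/commgP; apply: commute_cycle wy (cycle_id y).
rewrite /order_bound -/n expgzM -/w expr2 expgzM expgzB.
suff -> : expgz (expgz w (b - a)) b = expgz (expgz w (b - a)) a.
  by rewrite mulgV.
by rewrite expgzAC -wJ -conj_expgz (expgzAC w a) conj_expgz wyJ.
Qed.

End FiniteTriangle.

(** * Finiteness of triangle groups with torsion generators *)

Section NormalForm.
Variable G : groupType.
Implicit Types (x y z g : G).

(** Conjugation by negative powers of [y] is included: [<[x]>] is normalised,
    not just mapped into itself. *)
Definition power_normal x y :=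
  forall n i, exists j, expgz x i ^ expgz y n = expgz x j.

Lemma power_normalP x y a b : gcdz a b = 1%R ->
  expgz x a ^ y = expgz x b -> finite_order y -> power_normal x y.
Proof.
have iter t i : (exists j, x ^ t = expgz x j) ->
    forall n : nat, exists j, expgz x i ^ (t ^+ n) = expgz x j.
  case=> k xt; elim=> [|n [j IHn]]; first by exists i; rewrite conjg1.
  exists (k * j)%R; by rewrite expgSr conjgM IHn conj_expgz xt expgzM.
move=> ab xy fy [] n i; first exact/iter/(conj_is_power ab xy).
rewrite /= -expVgn; apply: iter; apply: (@conj_is_power _ _ _ b a).
- by rewrite gcdzC.
- by rewrite -xy conjgK.
by case: fy => k k0 yk; exists k; rewrite // expVgn yk invg1.
Qed.

Lemma power_push x y n i : power_normal x y ->
  exists j, expgz y n * expgz x i = expgz x j * expgz y n.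
Proof.
move=> /(_ (- n) i)%R [j]; rewrite expgzN => xj.
by exists j; rewrite conjgCV xj.
Qed.

Definition normal_form x y z g :=
  exists i j k, g = expgz x i * expgz y j * expgz z k.

Variables x y z : G.
Hypotheses (nxy : power_normal x y) (nyz : power_normal y z).
Hypothesis (nzx : power_normal z x).

Lemma normal_formMx n g :
  normal_form x y z g -> normal_form x y z (expgz x n * g).
Proof.
by case=> i [j [k ->]]; exists (n + i)%R, j, k; rewrite expgzD !mulgA.
Qed.

Lemma normal_formMy n g :
  normal_form x y z g -> normal_form x y z (expgz y n * g).
Proof.
case=> i [j [k ->]]; have [i' E] := power_push n i nxy.
by exists i', (n + j)%R, k; rewrite expgzD !mulgA E.
Qed.

Lemma normal_formMz n g :
  normal_form x y z g -> normal_form x y z (expgz z n * g).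
Proof.
case=> i [j [k ->]]; have [n' En] := nzx i n.
have [j' Ej] := power_push n' j nyz.
exists i, j', (n' + k)%R.
rewrite expgzD !mulgA (conjgC (expgz z n)) En.
by rewrite -(mulgA _ _ (expgz y j)) Ej !mulgA.
Qed.

End NormalForm.

Lemma normal_form_list (G : groupType) (x y z : G) :
    all_finite_order x y z -> (forall g, normal_form x y z g) ->
  exists s : seq G, forall g, g \in s.
Proof.
have pow g (n : nat) i : (0 < n)%N -> g ^+ n = 1 ->
    exists2 j, j \in iota 0 n & expgz g i = g ^+ j :> G.
  move=> n0 gn; have ni : (n%:Z != 0)%R by rewrite eqz_nat -lt0n.
  exists `|(i %% n)%Z|%N.
    by rewrite mem_iota /= add0n -ltz_nat gez0_abs ?modz_ge0 // ltz_pmod.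
  rewrite {1}(divz_eq i n) expgzD mulrC expgzM [expgz g n]gn expgz1n mul1g.
  by rewrite -{1}[(i %% _)%Z]gez0_abs ?modz_ge0.
case=> [[k k0 xk] [l l0 yl] [m m0 zm]] nf.
exists [seq x ^+ ij.1 * y ^+ ij.2 * z ^+ n |
         ij <- [seq (i, j) | i <- iota 0 k, j <- iota 0 l], n <- iota 0 m] => g.
have [i [j [n ->]]] := nf g.
have [i' i'k ->] := pow _ _ i k0 xk; have [j' j'l ->] := pow _ _ j l0 yl.
have [n' n'm ->] := pow _ _ n m0 zm.
apply/allpairsP; exists ((i', j'), n'); split=> //=.
by apply/allpairsP; exists (i', j').
Qed.

(** A copy of [G] whose finite type structure comes from a list [s] exhausting
    it. *)
Definition listed (G : groupType) (s : seq G) of (forall g, g \in s) : Type :=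
  G.

Section Listed.
Variables (G : groupType) (s : seq G) (sP : forall g, g \in s).
Local Notation L := (listed sP).

HB.instance Definition _ := Group.on L.

Lemma listed_indexK :
  cancel (fun g : L => index (g : G) s) (fun n => nth (1 : G) s n : L).
Proof. by move=> g; rewrite nth_index ?sP. Qed.

HB.instance Definition _ : isCountable L := CanIsCountable listed_indexK.

Lemma listed_enumP : Finite.axiom (undup s : seq L).
Proof.
move=> g; rewrite (count_uniq_mem g (undup_uniq (s : seq L))) mem_undup.
by rewrite (sP g).
Qed.

HB.instance Definition _ := isFinite.Build L listed_enumP.

End Listed.

Lemma finite_group_of_list (G : groupType) (s : seq G) : (forall g, g \in s) ->
  exists (Q : finGroupType) (h : {multiplicative G -> Q}), bijective h.
Proof.
move=> sP; exists (listed sP : finGroupType).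
pose f : G -> listed sP := id.
pose h : {multiplicative G -> listed sP} :=
  HB.pack f (isMultiplicative.Build _ _ f (fun _ _ => erefl)).
by exists h; exists id.
Qed.

(** * Homomorphisms of groups *)

Section GroupMorphisms.
Variables (G H : groupType) (q : {multiplicative G -> H}).

Lemma multiplicative1 : q 1 = 1.
Proof. by apply: (@mulgI _ (q 1)); rewrite -gmulfM !mulg1. Qed.

Lemma multiplicativeV g : q g^-1 = (q g)^-1.
Proof. by apply: (@mulgI _ (q g)); rewrite -gmulfM !mulgV multiplicative1. Qed.

Lemma multiplicativeX g n : q (g ^+ n) = q g ^+ n.
Proof.
by elim: n => [|n IHn]; rewrite ?multiplicative1 // !expgS gmulfM IHn.
Qed.

Lemma multiplicativeJ g h : q (g ^ h) = q g ^ q h.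
Proof. by rewrite /conjg !gmulfM multiplicativeV. Qed.

Lemma multiplicative_expgz g n : q (expgz g n) = expgz (q g) n.
Proof. by case: n => n /=; rewrite ?multiplicativeV multiplicativeX. Qed.

End GroupMorphisms.

(** * Adding relators to a presentation *)

Section MoreRelators.
Variables (X : choiceType) (rels extra : seq (word X * word X)).

Lemma pres_pi_letterV i : pres_pi rels [:: (i, true)] = (pres_gen rels i)^-1.
Proof. exact: (pres_pi_inv rels (word_gen i)). Qed.

Lemma presented_ind (P : presented rels -> Prop) :
    P 1 -> (forall i g, P g -> P (pres_gen rels i * g)) ->
    (forall i g, P g -> P ((pres_gen rels i)^-1 * g)) ->
  forall g, P g.
Proof.
move=> P1 Pg PV g; rewrite -[g]pres_reprK.
elim: (repr g) => [|[i s] u IHu]; first exact: P1.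
have -> : (i, s) :: u = ([:: (i, s)] : word X) * u by [].
rewrite gmulfM /=; case: s; last exact: Pg.
by rewrite pres_pi_letterV; exact: PV.
Qed.

Lemma word_eval_morph (H : groupType)
    (q : {multiplicative presented rels -> H}) u :
  word_eval (fun i => q (pres_gen rels i)) u = q (pres_pi rels u).
Proof.
elim: u => [|[i s] u IHu]; first by rewrite word_eval1 -(multiplicative1 q).
have -> : (i, s) :: u = ([:: (i, s)] : word X) * u by [].
rewrite word_evalM IHu !gmulfM /=; congr (_ * _).
rewrite /word_eval big_seq1 /letter_eval /=; case: s => //=.
by rewrite pres_pi_letterV multiplicativeV.
Qed.

Lemma pres_eq_cat u v : pres_eq rels u v -> pres_eq (rels ++ extra) u v.
Proof.
elim=> {u v}; [exact: pres_eq_refl | by move=> u v _; exact: pres_eq_sym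
  | by move=> u v w _ uv _; exact: pres_eq_trans
  | by move=> u u' v v' _ uu' _; exact: pres_eq_mul
  | exact: pres_eq_cancel |].
by move=> u v uv; apply: pres_eq_rel; rewrite mem_cat uv.
Qed.

Definition pres_quot (g : presented rels) : presented (rels ++ extra) :=
  pres_pi _ (repr g).

Lemma pres_quot_pi u : pres_quot (pres_pi rels u) = pres_pi _ u.
Proof. exact/pres_piP/pres_eq_cat/pres_eq_repr. Qed.

Lemma pres_quotM : {morph pres_quot : g h / g * h}.
Proof.
move=> g h; rewrite -[g]pres_reprK -[h]pres_reprK -gmulfM !pres_quot_pi.
exact: gmulfM.
Qed.

HB.instance Definition _ := isMultiplicative.Build _ _ pres_quot pres_quotM.

Lemma pres_quot_surj : surjective pres_quot.
Proof.
by move=> g; exists (pres_pi rels (repr g)); rewrite pres_quot_pi pres_reprK.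
Qed.

Lemma pres_quot_factor (H : groupType)
    (q : {multiplicative presented rels -> H}) :
    (forall u v, (u, v) \in extra -> q (pres_pi rels u) = q (pres_pi rels v)) ->
  exists r : {multiplicative presented (rels ++ extra) -> H},
    forall g, q g = r (pres_quot g).
Proof.
move=> qextra; pose h i := q (pres_gen rels i).
have hrels u v : (u, v) \in rels ++ extra -> word_eval h u = word_eval h v.
  rewrite !word_eval_morph mem_cat => /orP[/pres_pi_rel->|] //; exact: qextra.
pose r0 : presented (rels ++ extra) -> H := pres_lift h (rels := rels ++ extra).
pose r : {multiplicative presented (rels ++ extra) -> H} :=
  HB.pack r0 (isMultiplicative.Build _ _ r0 (pres_liftM hrels)).
exists r => g; rewrite -[g]pres_reprK pres_quot_pi /=.
by rewrite -word_eval_morph /r0 (pres_lift_pi hrels).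
Qed.

End MoreRelators.

(** * The universal quotient *)

Section Truncation.
Variables a b c d e f : int.
Let G := Ggroup a b c d e f.
Let x := Gx a b c d e f.
Let y := Gy a b c d e f.
Let z := Gz a b c d e f.

Lemma Ggroup_triangle (H : groupType) (q : {multiplicative G -> H}) :
  triangle a b c d e f (q x) (q y) (q z).
Proof.
split; rewrite -!multiplicative_expgz -multiplicativeJ;
  by rewrite ?Gxy_rel ?Gyz_rel ?Gzx_rel.
Qed.

Definition order_rels (k l m : nat) : seq (word 'I_3 * word 'I_3) :=
  [:: ((word_gen (inord 0) : word 'I_3) ^+ k, 1);
      ((word_gen (inord 1) : word 'I_3) ^+ l, 1);
      ((word_gen (inord 2) : word 'I_3) ^+ m, 1)].

Definition truncation k l m : groupType :=
  presented (G_rels a b c d e f ++ order_rels k l m).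

Definition trunc k l m : {multiplicative G -> truncation k l m} :=
  pres_quot (rels := G_rels a b c d e f) (order_rels k l m).

Lemma trunc_gen k l m i :
  trunc k l m (pres_gen (G_rels a b c d e f) i) = pres_gen _ i.
Proof. exact: pres_quot_pi. Qed.

Lemma trunc_orders k l m :
  [/\ trunc k l m x ^+ k = 1, trunc k l m y ^+ l = 1 & trunc k l m z ^+ m = 1].
Proof.
rewrite !trunc_gen /pres_gen -!gmulfXn.
by split; apply: (pres_pi_rel (v := 1)); rewrite mem_cat !inE !eqxx !orbT.
Qed.

Lemma trunc_factor k l m (H : groupType) (q : {multiplicative G -> H}) :
    q x ^+ k = 1 -> q y ^+ l = 1 -> q z ^+ m = 1 ->
  exists r : {multiplicative truncation k l m -> H},
    forall g, q g = r (trunc k l m g).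
Proof.
move=> xk yl zm; apply: pres_quot_factor => u v.
rewrite !inE => /or3P[] /eqP[-> ->];
  by rewrite !gmulfXn !multiplicativeX !gmulf1 !multiplicative1.
Qed.

Lemma I3_cases (i : 'I_3) : [\/ i = inord 0, i = inord 1 | i = inord 2].
Proof.
case: i => [[|[|[|]]] //] lt_i3;
  [constructor 1 | constructor 2 | constructor 3];
  by apply: val_inj; rewrite /= inordK.
Qed.

Lemma trunc_ind k l m (P : truncation k l m -> Prop) :
    P 1 ->
    (forall t g, t \in [:: trunc k l m x; trunc k l m y; trunc k l m z] ->
      P g -> P (t * g) /\ P (t^-1 * g)) ->
  forall g, P g.
Proof.
move=> P1 PM; apply: presented_ind => // i g Pg; apply PM => //;
  by rewrite !trunc_gen !inE; case: (I3_cases i) => ->; rewrite eqxx ?orbT.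
Qed.

Hypotheses (ab : admissible a b) (cd : admissible c d) (ef : admissible e f).

Let gab : gcdz a b = 1%R. Proof. by case: ab. Qed.
Let gcd_cd : gcdz c d = 1%R. Proof. by case: cd. Qed.
Let gef : gcdz e f = 1%R. Proof. by case: ef. Qed.

Lemma trunc_finite k l m : (0 < k)%N -> (0 < l)%N -> (0 < m)%N ->
  exists (Q : finGroupType) (h : {multiplicative truncation k l m -> Q}),
    bijective h.
Proof.
move=> k0 l0 m0; have [xk yl zm] := trunc_orders k l m.
have [xy yz zx] := Ggroup_triangle (trunc k l m).
have fx : finite_order (trunc k l m x) by exists k.
have fy : finite_order (trunc k l m y) by exists l.
have fz : finite_order (trunc k l m z) by exists m.
have nxy := power_normalP gab xy fy; have nyz := power_normalP gcd_cd yz fz.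
have nzx := power_normalP gef zx fx.
have [|s] := @normal_form_list (truncation k l m) (trunc k l m x)
  (trunc k l m y) (trunc k l m z) (And3 fx fy fz);
  last exact: finite_group_of_list.
apply: trunc_ind => [|t g]; first by exists 0%R, 0%R, 0%R; rewrite /= !mulg1.
rewrite !inE => /or3P[] /eqP-> nf.
- by split; [exact: (normal_formMx 1 nf) | exact: (normal_formMx (- 1) nf)].
- by split; [exact: (normal_formMy nxy 1 nf)
    | exact: (normal_formMy nxy (- 1) nf)].
by split; [exact: (normal_formMz nyz nzx 1 nf)
  | exact: (normal_formMz nyz nzx (- 1) nf)].
Qed.

Lemma trunc_generates k l m (Q : finGroupType)
    (h : {multiplicative truncation k l m -> Q}) :
  bijective h ->
  [set: Q] = <<[set h (trunc k l m x); h (trunc k l m y); h (trunc k l m z)]>>.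
Proof.
case=> h' _ hK; apply/esym/eqP; rewrite eqEsubset subsetT; apply/subsetP=> g _.
rewrite -[g]hK; elim/trunc_ind: (h' g) => [|t {}g].
  by rewrite multiplicative1 group1.
rewrite !inE => tP gQ; have htQ : h t \in <<[set h (trunc k l m x);
    h (trunc k l m y); h (trunc k l m z)]>>.
  by case/or3P: tP => /eqP->; rewrite mem_gen // !inE eqxx ?orbT.
by rewrite !gmulfM multiplicativeV !groupM ?groupV.
Qed.

(** The bounds are proved in finite groups; they reach [H] through the finite
    truncation of [G] at the orders, whatever they are, of the three
    generators in [H]. *)
Lemma finite_order_bound (H : groupType) (q : {multiplicative G -> H}) :
    all_finite_order (q x) (q y) (q z) ->
  [/\ q x ^+ `|order_bound a b c d|%N = 1,
      q y ^+ `|order_bound c d e f|%N = 1 &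
      q z ^+ `|order_bound e f a b|%N = 1].
Proof.
case=> [[k k0 xk] [l l0 yl] [m m0 zm]].
have [r qr] := trunc_factor xk yl zm.
have [Q [h [h' hK _]]] := trunc_finite k0 l0 m0.
pose p : {multiplicative G -> Q} := h \o trunc k l m.
have T := Ggroup_triangle p.
have back g n : p g ^+ n = 1 -> q g ^+ n = 1.
  move=> pgn; have tgn : trunc k l m g ^+ n = 1.
    by apply: (can_inj hK); rewrite multiplicativeX multiplicative1.
  by rewrite qr -multiplicativeX tgn multiplicative1.
split; apply/back/expgz_abs.
- exact: triangle_order_bound T.
- exact: triangle_order_bound (triangle_rot T).
exact: triangle_order_bound (triangle_rot (triangle_rot T)).
Qed.

End Truncation.

Lemma admissibleP a b : a <> 0%R -> b <> 0%R -> gcdz a b = 1%R ->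
    ~ ((a = 1%R \/ a = (-1)%R) /\ (b = 1%R \/ b = (-1)%R)) ->
  admissible a b.
Proof.
move=> /eqP a0 /eqP b0 ab ab1; split=> //; apply/eqP=> abs; apply: ab1.
have a1 : `|a|%N = 1%N.
  by move: ab => [] ; rewrite -abs gcdnn.
have b1 : `|b|%N = 1%N by rewrite -abs.
have pm1 (n : int) : `|n|%N = 1%N -> n = 1%R \/ n = (-1)%R.
  case: n => [n /= ->|n [->]]; first by left.
  by right.
by split; apply: pm1.
Qed.

Theorem theorem2 (a b c d e f : int) :
  a <> 0%R -> b <> 0%R -> c <> 0%R -> d <> 0%R -> e <> 0%R -> f <> 0%R ->
  gcdz a b = 1%R -> gcdz c d = 1%R -> gcdz e f = 1%R ->
  ~ ((a = 1%R \/ a = (-1)%R) /\ (b = 1%R \/ b = (-1)%R)) ->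
  ~ ((c = 1%R \/ c = (-1)%R) /\ (d = 1%R \/ d = (-1)%R)) ->
  ~ ((e = 1%R \/ e = (-1)%R) /\ (f = 1%R \/ f = (-1)%R)) ->
  exists (Q : finGroupType)
         (p : {multiplicative Ggroup a b c d e f -> Q}),
    [/\ surjective p,
        [/\ finite_order (p (Gx a b c d e f)),
            finite_order (p (Gy a b c d e f)) &
            finite_order (p (Gz a b c d e f))],
        forall (H : groupType)
               (q : {multiplicative Ggroup a b c d e f -> H}),
          surjective q ->
          finite_order (q (Gx a b c d e f)) ->
          finite_order (q (Gy a b c d e f)) ->
          finite_order (q (Gz a b c d e f)) ->
          exists r : {multiplicative Q -> H}, forall g, q g = r (p g),
        [/\ solvable [set: Q],
            nilpotent [set: Q]^`(1)%g &
            (nil_class [set: Q]^`(1)%g <= 2)%N] &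
        1%R \in [:: a; b; c; d; e; f] ->
          bijective p].
Proof.
move=> a0 b0 c0 d0 e0 f0 gab gcd gef ab1 cd1 ef1.
have ab := admissibleP a0 b0 gab ab1; have cd := admissibleP c0 d0 gcd cd1.
have ef := admissibleP e0 f0 gef ef1.
have bound_gt0 i j k l : admissible i j -> admissible k l ->
    (0 < `|order_bound i j k l|)%N.
  by move=> ij kl; rewrite absz_gt0 order_bound_neq0.
pose k := `|order_bound a b c d|%N; pose l := `|order_bound c d e f|%N.
pose m := `|order_bound e f a b|%N.
have [Q [h bij_h]] : exists (Q : finGroupType)
    (h : {multiplicative truncation a b c d e f k l m -> Q}), bijective h.
  by apply: trunc_finite => //; apply: bound_gt0.
have [h' hK h'K] := bij_h.
have h'M : {morph h' : g1 g2 / g1 * g2} := can2_gmulfM hK h'K.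
pose p : {multiplicative Ggroup a b c d e f -> Q} :=
  h \o trunc a b c d e f k l m.
have univ (H : groupType) (q : {multiplicative Ggroup a b c d e f -> H}) :
    all_finite_order (q (Gx a b c d e f)) (q (Gy a b c d e f))
      (q (Gz a b c d e f)) ->
    exists r : {multiplicative Q -> H}, forall g, q g = r (p g).
  move=> /(finite_order_bound ab cd ef)[qx qy qz].
  have [r qr] := trunc_factor qx qy qz.
  pose h'm : {multiplicative Q -> _} :=
    HB.pack h' (isMultiplicative.Build _ _ h' h'M).
  by exists (r \o h'm) => g /=; rewrite hK qr.
have p_surj : surjective p.
  move=> g; have [g' Eg] := pres_quot_surj (h' g).
  by exists g'; rewrite /p /= -[g in RHS]h'K -Eg.
exists Q, p; split=> //.
- by split; exact: finite_order_fin.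
- by move=> H q _ qx qy qz; apply: univ.
- have [nxy nyz nzx] := triangle_norms gab gcd gef (Ggroup_triangle p).
  have cl2 := nil_class_three_cycles nxy nyz nzx.
  rewrite -(trunc_generates bij_h) in cl2.
  have nil : nilpotent [set: Q]^`(1).
    exact: small_nil_class (leq_trans cl2 _).
  split=> //; rewrite (series_sol (der_normal 1 _)) nilpotent_sol //=.
  exact/abelian_sol/der_abelian.
move=> /(triangle_unit_exponent ab cd ef (Ggroup_triangle idfun))/univ[r pr].
exists r => [g|g]; first by rewrite -pr.
by have [g' <-] := p_surj g; rewrite -pr.
Qed.
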